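(* Let $(\Gamma,\Lambda)$ be a Hecke pair, and suppose that $\Lambda$ is neither amenable nor co-amenable in $\Gamma$. Then, for every spread-out and $\Lambda$-absorbing probability measure $\tau$ on $\Gamma$, the measured group $(\Gamma,\tau)$ is not prime.
   Context: $\Gamma$ is a countable discrete group and $\Lambda<\Gamma$. $(\Gamma,\Lambda)$ is a Hecke pair if $\Lambda\cap\gamma\Lambda\gamma^{-1}$ has finite index in $\Lambda$ for every $\gamma\in\Gamma$. $\Lambda$ is co-amenable in $\Gamma$ if there is a $\Gamma$-invariant mean on $\ell^\infty(\Gamma/\Lambda)$. A probability measure $\tau$ on $\Gamma$ is $\Lambda$-absorbing if $\alpha_*\tau(\gamma\Lambda)=\sum_{\lambda\in\Lambda}\tau(\gamma\lambda)$ defines a left-$\Lambda$-invariant measure on $\Gamma/\Lambda$. $\tau$ is spread-out if its support generates $\Gamma$ as a semigroup; then $(\Gamma,\tau)$ is called a measured group. A Borel $(\Gamma,\tau)$-space $(X,\xi)$ is a standard Borel space $X$ with Borel $\Gamma$-action and a probability measure $\xi$ with $\tau*\xi=\sum_\gamma\tau(\gamma)\gamma\xi=\xi$. A measure-preserving $\Gamma$-map $(X,\xi)\to(X',\xi')$ is a $\Gamma$-equivariant Borel map between $\Gamma$-invariant conull Borel subsets pushing $\xi$ to $\xi'$; if it has a measurable inverse of the same kind it is a measurable $\Gamma$-isomorphism. A compact model of $(X,\xi)$ is a compact metrizable space $M$ with continuous $\Gamma$-action and a $\tau$-stationary probability measure $\eta$ such that $(M,\eta)$ is measurably $\Gamma$-isomorphic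 to $(X,\xi)$; for $\tau^{\otimes\mathbb N}$-a.e. $\omega$ the weak*-limit $\eta_\omega=\lim_n\omega_1\cdots\omega_n\eta$ exists. $(X,\xi)$ is $\tau$-proximal (a $\tau$-boundary) if for its compact models $\eta_\omega$ is a.s. a point measure. The Poisson boundary of $(\Gamma,\tau)$ is the (unique up to measurable $\Gamma$-isomorphism) $\tau$-boundary $(B,\nu)$ such that every $\tau$-boundary is the image of $(B,\nu)$ under a measure-preserving $\Gamma$-map, and such that $f\mapsto\big(\gamma\mapsto\int_B f(\gamma b)\,d\nu(b)\big)$ is an isometric isomorphism from $L^\infty(B,\nu)$ onto the bounded functions $\varphi$ on $\Gamma$ satisfying $\varphi(\gamma)=\sum_\eta\varphi(\gamma\eta)\tau(\eta)$. A non-trivial (not concentrated at one point) Borel $(\Gamma,\tau)$-space is prime if every measure-preserving $\Gamma$-map from it to another $(\Gamma,\tau)$-space is either a measurable $\Gamma$-isomorphism or has target equal, modulo null sets, to a single point. The measured group $(\Gamma,\tau)$ is prime if its Poisson boundary is prime. *)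

(* Defs.v *)
(* MathComp / MathComp-Analysis *)
From HB Require Import structures.
From mathcomp Require Import all_boot all_order all_algebra.
From mathcomp Require Import all_classical all_reals all_analysis.

Set Implicit Arguments.
Unset Strict Implicit.
Unset Printing Implicit Defensive.

Import Order.TTheory GRing.Theory Num.Theory.
Import numFieldNormedType.Exports.

Local Open Scope classical_set_scope.
Local Open Scope ring_scope.

(* ** Subgroups, cosets, means *)

Definition translate (G : groupType) (g : G) (A : set G) : set G :=
  [set (g * x)%g | x in A].

Definition coset_space (G : groupType) (L : groupClosed G) : set (set G) :=
  [set translate g [set` L] | g in [set: G]].

(* [H : K] is finite; K is meant to be a subgroup of H. *)
Definition finite_index (G : groupType) (K H : set G) : Prop :=
  finite_set [set translate h K | h in H].

Definition hecke_pair (G : groupType) (L : groupClosed G) : Prop :=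
  forall g : G,
    finite_index ([set` L] `&` [set (g * x * g^-1)%g | x in [set` L]]) [set` L].

(* A mean on l^oo(D), for D a subset of T: elements of l^oo(D) are represented
   by functions on T that are bounded on D, two such functions being identified
   when they agree on D. *)
Record is_mean (R : realType) (T : Type) (D : set T) (m : (T -> R) -> R) :
    Prop := IsMean {
  mean_ext : forall f g : T -> R, (forall x, D x -> f x = g x) -> m f = m g;
  mean_linear : forall (a : R) (f g : T -> R),
    [bounded f x | x in D] -> [bounded g x | x in D] ->
    m (fun x => a * f x + g x) = a * m f + m g;
  mean_ge0 : forall f : T -> R,
    [bounded f x | x in D] -> (forall x, D x -> 0 <= f x) -> 0 <= m f;
  mean_one : m (fun=> 1) = 1 }.

(* S acts on l^oo(D) by (g . f) x = f (g^-1 x). *)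
Definition has_invariant_mean (R : realType) (G : groupType) (T : Type)
    (S : set G) (D : set T) (act : G -> T -> T) : Prop :=
  exists2 m : (T -> R) -> R, is_mean D m &
    forall (g : G) (f : T -> R), S g -> [bounded f x | x in D] ->
      m (fun x => f (act g^-1%g x)) = m f.

Definition amenable (R : realType) (G : groupType) (L : groupClosed G) : Prop :=
  has_invariant_mean R [set` L] [set` L] (fun g x : G => (g * x)%g).

Definition coamenable (R : realType) (G : groupType) (L : groupClosed G) :
    Prop :=
  has_invariant_mean R [set: G] (coset_space L) (@translate G).

(* ** Probability measures on a discrete group *)

(* The group G with the sigma-algebra of all its subsets. *)
Definition discrete (G : groupType) : Type := G.

HB.instance Definition _ (G : groupType) := Choice.on (discrete G).
HB.instance Definition _ (G : groupType) := isPointed.Build (discrete G) 1%g.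
HB.instance Definition _ (G : groupType) :=
  @isMeasurable.Build default_measure_display (discrete G)
    discrete_measurable discrete_measurable0
    discrete_measurableC discrete_measurableU.

Definition spread_out (R : realType) (G : groupType)
    (tau : probability (discrete G) R) : Prop :=
  forall S : set G,
    (forall g : G, (0 < tau [set g])%E -> S g) ->
    (forall g h : G, S g -> S h -> S (g * h)%g) ->
    S = [set: G].

(* The mass of the coset g L under the image of tau in G / L. *)
Definition coset_mass (R : realType) (G : groupType) (L : groupClosed G)
    (tau : probability (discrete G) R) (g : G) : \bar R :=
  (\esum_(l in [set` L]) tau [set (g * l)%g])%E.

Definition absorbing (R : realType) (G : groupType) (L : groupClosed G)
    (tau : probability (discrete G) R) : Prop :=
  forall l g : G, l \in L ->
    coset_mass L tau (l * g)%g = coset_mass L tau g.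

Definition cylinder (G : groupType) (s : seq G) : set (nat -> discrete G) :=
  [set w | forall i, (i < size s)%N -> w i = nth 1%g s i].

Definition cylinders (G : groupType) : set (set (nat -> discrete G)) :=
  range (@cylinder G).

(* P is the product measure tau^{(x) N} on G^N (indices start at 0): it is the
   unique probability measure on the product sigma-algebra with these values on
   cylinders. *)
Definition is_power_measure (R : realType) (G : groupType)
    (tau : probability (discrete G) R)
    (P : probability (g_sigma_algebraType (@cylinders G)) R) : Prop :=
  forall s : seq G, P (cylinder s) = (\prod_(g <- s) tau [set g])%E.

(* ** (G, tau)-spaces *)

Definition borel (T : ptopologicalType) := g_sigma_algebraType (@open T).

Definition polish (R : realType) (T : completePseudoMetricType R) : Prop :=
  hausdorff_space T /\ exists2 D : set T, countable D & dense D.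

Definition standard_borel (R : realType) d (X : measurableType d) : Prop :=
  exists (T : completePseudoMetricType R) (f : X -> borel T) (g : borel T -> X),
    [/\ polish T, measurable_fun setT f, measurable_fun setT g,
        cancel f g & cancel g f].

Definition is_action (G : groupType) (T : Type) (a : G -> T -> T) : Prop :=
  (forall x, a 1%g x = x) /\ (forall g h x, a (g * h)%g x = a g (a h x)).

(* The raw data of a probability space with an action of G; the axioms are in
   [borel_gspace]. *)
Record gspace (R : realType) (G : groupType) := GSpace {
  gdisp : measure_display;
  gcarrier :> measurableType gdisp;
  gact : G -> gcarrier -> gcarrier;
  glaw : probability gcarrier R }.

Definition stationary (R : realType) (G : groupType)
    (tau : probability (discrete G) R) (X : gspace R G) : Prop :=
  forall A : set X, measurable A ->
    (\esum_(g in [set: G]) (tau [set g] * pushforward (glaw X) (gact g) A)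
       = glaw X A)%E.

Record borel_gspace (R : realType) (G : groupType)
    (tau : probability (discrete G) R) (X : gspace R G) : Prop := BorelGSpace {
  gspace_standard : standard_borel R X;
  gspace_action : is_action (@gact R G X);
  gspace_measurable : forall g : G, measurable_fun setT (@gact R G X g);
  gspace_stationary : stationary tau X }.

Definition trivial_gspace (R : realType) (G : groupType) (X : gspace R G) :
    Prop :=
  exists x : X, glaw X [set x] = 1%E.

Definition invariant_conull (R : realType) (G : groupType) (X : gspace R G)
    (X0 : set X) : Prop :=
  [/\ measurable X0, forall (g : G) (x : X), X0 x -> X0 (gact g x)
    & glaw X (~` X0) = 0%E].

(* f restricts to a measure-preserving G-map X0 -> Y0; the values of f outside
   of X0 are irrelevant. *)
Record gmap_between (R : realType) (G : groupType) (X Y : gspace R G)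
    (X0 : set X) (Y0 : set Y) (f : X -> Y) : Prop := GMapBetween {
  gmap_dom : invariant_conull X0;
  gmap_cod : invariant_conull Y0;
  gmap_sub : forall x, X0 x -> Y0 (f x);
  gmap_meas : measurable_fun X0 f;
  gmap_equiv : forall g x, X0 x -> f (gact g x) = gact g (f x);
  gmap_push : forall B : set Y, measurable B ->
    glaw X (X0 `&` f @^-1` B) = glaw Y B }.

Definition gmap (R : realType) (G : groupType) (X Y : gspace R G)
    (f : X -> Y) : Prop :=
  exists (X0 : set X) (Y0 : set Y), gmap_between X0 Y0 f.

(* Maps are taken modulo null sets: f has to be invertible between suitable
   invariant conull sets, possibly smaller than those witnessing [gmap f]. *)
Definition giso (R : realType) (G : groupType) (X Y : gspace R G)
    (f : X -> Y) : Prop :=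
  exists (X0 : set X) (Y0 : set Y) (h : Y -> X),
    [/\ gmap_between X0 Y0 f, gmap_between Y0 X0 h,
        forall x, X0 x -> h (f x) = x & forall y, Y0 y -> f (h y) = y].

(* ** Compact models, proximality *)

Record compact_model (R : realType) (G : groupType)
    (tau : probability (discrete G) R) (X : gspace R G)
    (M : pseudoPMetricType R) (a : G -> M -> M)
    (eta : probability (borel M) R) : Prop := CompactModel {
  model_compact : compact [set: M];
  model_hausdorff : hausdorff_space M;
  model_action : is_action a;
  model_continuous : forall g : G, continuous (a g);
  model_stationary : stationary tau (@GSpace R G _ (borel M) a eta);
  model_iso : exists f, @giso R G (@GSpace R G _ (borel M) a eta) X f }.

Definition weakstar_cvg (R : realType) (M : ptopologicalType)
    (mu_ : nat -> probability (borel M) R) (mu : probability (borel M) R) :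
    Prop :=
  forall f : M -> R, continuous f ->
    \int[mu_ n]_x f x @[n --> \oo] --> \int[mu]_x f x.

Lemma continuous_borel (M N : ptopologicalType) (f : M -> N) :
  continuous f -> measurable_fun setT (f : borel M -> borel N).
Proof.
move=> cf; apply: (@measurability _ _ (borel M) (borel N) _ _ (@open N)) => //.
move=> _ [B oB <-]; rewrite setTI; apply: sub_sigma_algebra.
by move/continuousP: cf; exact.
Qed.

Definition continuous_mfun (M N : ptopologicalType) (f : M -> N)
    (cf : continuous f) : {mfun borel M >-> borel N} :=
  HB.pack_for {mfun borel M >-> borel N} (f : borel M -> borel N)
    (isMeasurableFun.Build _ _ (borel M) (borel N) f (continuous_borel cf)).

(* The increments of the random walk are w 0, w 1, ..., so that its position at
   time n is the product w 0 * ... * w n.-1. *)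
Definition proximal (R : realType) (G : groupType)
    (tau : probability (discrete G) R) (X : gspace R G) : Prop :=
  forall (M : pseudoPMetricType R) (a : G -> M -> M)
      (eta : probability (borel M) R) (Mmodel : compact_model tau X a eta),
  forall P : probability (g_sigma_algebraType (@cylinders G)) R,
    is_power_measure tau P ->
  {ae P, forall w : nat -> G, exists x : M,
    weakstar_cvg
      (fun n => distribution eta
        (continuous_mfun
           (@model_continuous _ _ _ _ _ _ _ Mmodel (\prod_(i < n) w i)%g)))
      (\d_(x : borel M))}.

Definition boundary (R : realType) (G : groupType)
    (tau : probability (discrete G) R) (X : gspace R G) : Prop :=
  borel_gspace tau X /\ proximal tau X.

(* ** The Poisson boundary, prime measured groups *)

Definition bounded_harmonic (R : realType) (G : groupType)
    (tau : probability (discrete G) R) (phi : G -> R) : Prop :=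
  bounded_fun phi /\
  forall g : G, phi g = \int[tau]_h phi (g * h)%g.

Definition poisson_transform (R : realType) (G : groupType) (X : gspace R G)
    (f : X -> R) (g : G) : R :=
  \int[glaw X]_b f (gact g b).

Record poisson_boundary (R : realType) (G : groupType)
    (tau : probability (discrete G) R) (B : gspace R G) : Prop :=
  PoissonBoundary {
  poisson_is_boundary : boundary tau B;
  poisson_universal : forall X : gspace R G, boundary tau X ->
    exists f : B -> X, gmap f;
  poisson_harmonic : forall f : B -> R, f \in Lfun (glaw B) +oo%E ->
    bounded_harmonic tau (poisson_transform f);
  poisson_isometry : forall f : B -> R, f \in Lfun (glaw B) +oo%E ->
    ereal_sup (range (fun g : G => `|poisson_transform f g|%:E))
      = ('N[glaw B]_(+oo%E)[EFin \o f])%E;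
  poisson_onto : forall phi : G -> R, bounded_harmonic tau phi ->
    exists2 f : B -> R, f \in Lfun (glaw B) +oo%E &
      poisson_transform f = phi }.

Definition prime_gspace (R : realType) (G : groupType)
    (tau : probability (discrete G) R) (X : gspace R G) : Prop :=
  [/\ borel_gspace tau X, ~ trivial_gspace X &
      forall (Y : gspace R G) (f : X -> Y),
        borel_gspace tau Y -> gmap f -> giso f \/ trivial_gspace Y].

Definition prime_measured_group (R : realType) (G : groupType)
    (tau : probability (discrete G) R) : Prop :=
  exists2 B : gspace R G, poisson_boundary tau B & prime_gspace tau B.

(* Main.v *)
(* Write P f g for the integral of f (g h) dtau(h). Ultralimits of the Cesaro
   means of the iterates of P give a positive, left-equivariant projection E of
   l^oo(Gamma) onto the bounded harmonic functions; as tau is Lambda-absorbing, E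
   preserves right Lambda-invariance. If all bounded harmonic functions are right
   Lambda-invariant, then evaluating E at 1 produces a Lambda-invariant mean on
   Lambda; if the right Lambda-invariant ones are all constant, it produces a
   Gamma-invariant mean on Gamma / Lambda. Both being excluded, there is a
   non-constant right Lambda-invariant bounded harmonic function, and not all
   bounded harmonic functions are right Lambda-invariant.

   The Poisson transform is an isometry onto the bounded harmonic functions, hence
   an order isomorphism, and so it carries max(f, f') to E applied to the maximum
   of the two transforms. It follows that the measurable subsets of B whose
   indicator has a right Lambda-invariant transform form a Gamma-invariant
   sigma-algebra S, and that S contains a set A with 0 < nu(A) < 1. Recording the
   visits of g^-1 b to A defines a non-trivial factor of B in the Cantor space. If B
   were prime, this factor map would be an isomorphism, so S would contain all
   measurable sets, and all bounded harmonic functions would be right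
   Lambda-invariant. *)
Require Import Defs.
From HB Require Import structures.
From mathcomp Require Import all_boot all_order all_algebra.
From mathcomp Require Import all_classical all_reals all_analysis.
From mathcomp Require Import measurable_realfun ess_sup_inf.
From mathcomp Require Import ring.

Set Implicit Arguments.
Unset Strict Implicit.
Unset Printing Implicit Defensive.

Import Order.TTheory GRing.Theory Num.Theory.
Import numFieldNormedType.Exports.

Local Open Scope classical_set_scope.
Local Open Scope ring_scope.

(** * Bounded functions and ultralimits *)

Lemma boundedP (R : realType) (T : Type) (D : set T) (f : T -> R) :
  [bounded f x | x in D] <-> exists M : R, forall x, D x -> `|f x| <= M.
Proof.
split=> [[M [_ fM]]|[M fM]].
  by exists (M + 1) => x Dx; apply: (fM (M + 1)) => //; rewrite ltrDl.
exists M; split; first exact: num_real.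
by move=> N MN x Dx; apply: le_trans (fM x Dx) (ltW MN).
Qed.

Lemma bounded_byP (R : realType) (T : Type) (f : T -> R) :
  bounded_fun f <-> exists M : R, forall x, `|f x| <= M.
Proof.
by split=> [/boundedP[M fM]|[M fM]]; [exists M => x; exact: fM|
  apply/boundedP; exists M].
Qed.

Section bounded_integrals.
Context d (X : measurableType d) (R : realType) (P : probability X R).
Implicit Types f g : X -> R.

Lemma bounded_integrable f :
  measurable_fun setT f -> bounded_fun f -> P.-integrable setT (EFin \o f).
Proof.
move=> mf bf; apply: measurable_bounded_integrable => //.
by apply: le_lt_trans (probability_le1 _ measurableT) _; rewrite ltry.
Qed.

Lemma Rintegral_cstT (r : R) : \int[P]_x r = r.
Proof. by rewrite Rintegral_cst//= (probability_setT P) mulr1. Qed.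

Lemma Rintegral_norm_le f (M : R) : measurable_fun setT f ->
  (forall x, `|f x| <= M) -> `|\int[P]_x f x| <= M.
Proof.
move=> mf fM; have bf : bounded_fun f by apply/bounded_byP; exists M.
have bM : bounded_fun (fun _ : X => M) by apply/bounded_byP; exists `|M|.
have h : P.-integrable setT (EFin \o (fun x => `|f x|)).
  apply: bounded_integrable; first exact: measurableT_comp.
  by apply/bounded_byP; exists M => x; rewrite /= normr_id.
rewrite (le_trans (le_normr_Rintegral _ _))//; first exact: bounded_integrable.
rewrite -[leRHS]Rintegral_cstT; apply: le_Rintegral => //.
by apply: bounded_integrable.
Qed.
End bounded_integrals.

Section ultralimit.
Context (R : realType) (U : set_system nat) (UU : UltraFilter U).
Implicit Types u v : nat -> R.

(** The values stay in a compact segment, so the image of [U] has a cluster point. Along an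
    ultrafilter a cluster point is a limit: [U] contains either the preimage of a given
    neighbourhood or the complement of that preimage. *)
Lemma ultra_cvg u : bounded_fun u -> cvg (u @ U).
Proof.
move=> /bounded_byP[M uM].
have cM : compact [set` `[-M, M]] by exact: segment_compact.
have UM : (u @ U) [set` `[-M, M]].
  rewrite /= nbhs_simpl; apply: filterS filterT => n _ /=.
  by rewrite in_itv /= -ler_norml.
have [p [_ clp]] := cM (u @ U) _ UM.
apply/cvg_ex; exists p => V Vp.
have [//|UV] := in_ultra_setVsetC (u @^-1` V) UU.
by have [x [/=]] := clp (~` V) V UV Vp.
Qed.

Definition ulim u : R := lim (u @ U).

Lemma ulim_cvg u l : u @ U --> l -> ulim u = l.
Proof. exact: cvg_lim. Qed.

Lemma ulim_linear a u v : bounded_fun u -> bounded_fun v ->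
  ulim (fun n => a * u n + v n) = a * ulim u + ulim v.
Proof.
move=> bu bv; apply: ulim_cvg; apply: cvgD; last exact: ultra_cvg.
by apply: cvgM; [exact: cvg_cst|exact: ultra_cvg].
Qed.

Lemma ulim_le u M : bounded_fun u -> (forall n, u n <= M) -> ulim u <= M.
Proof.
by move=> bu uM; apply: limr_le; [exact: ultra_cvg|exact: nearW].
Qed.

Lemma ulim_ge u M : bounded_fun u -> (forall n, M <= u n) -> M <= ulim u.
Proof.
by move=> bu uM; apply: limr_ge; [exact: ultra_cvg|exact: nearW].
Qed.

Lemma ulim_norm u M : (forall n, `|u n| <= M) -> `|ulim u| <= M.
Proof.
move=> uM; have bu : bounded_fun u by apply/bounded_byP; exists M.
rewrite ler_norml; apply/andP; split.
  by apply: ulim_ge => // n; have := uM n; rewrite ler_norml => /andP[].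
by apply: ulim_le => // n; have := uM n; rewrite ler_norml => /andP[].
Qed.

End ultralimit.

(** * Exchanging ultralimits with integration against [tau] *)

Section discrete.
Context (R : realType) (G : groupType) (tau : probability (discrete G) R).
Hypothesis Gcount : countable [set: G].

(** An injection of the group into [nat] exhausts it by an increasing sequence of finite sets, and
    [tau] is continuous from below. *)
Lemma discrete_tail (e : R) : 0 < e ->
  exists2 K : set (discrete G), finite_set K & fine (tau (~` K)) <= e.
Proof.
move=> e0; have /countable_injP[c cinj] := Gcount.
pose K n : set (discrete G) := [set g | (c g < n)%N].
have finK n : finite_set (K n).
  apply: (@sub_finite_set _ _ (c @^-1` `I_n)) => //.
  apply: finite_preimage => //.
  by move=> x y _ _ xy; apply: cinj => //; apply/mem_set.
have tK : tau (K n) @[n --> \oo] --> tau setT.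
  have -> : [set: discrete G] = \bigcup_n K n.
    by apply/seteqP; split => [g _|//]; exists (c g).+1 => //;
      rewrite /K /= ltnSn.
  apply: nondecreasing_cvg_mu => //.
  by move=> m n mn; apply/subsetPset => g /= cm; exact: leq_trans cm mn.
have /fine_cvgP[_ /cvgrPdist_le/(_ e e0)] : tau (K n) @[n --> \oo] --> (1:R)%:E.
  by rewrite -(probability_setT tau).
case=> N _ /(_ N (leqnn _)) /= h.
exists (K N) => //; rewrite probability_setC//.
have tf : tau (K N) \is a fin_num by exact: fin_num_measure.
by rewrite fineB//=; apply: le_trans (ler_norm _) h.
Qed.

(* Dominated convergence fails along an ultrafilter in general; here tightness of
   tau reduces the claim to finitely many points. *)
Lemma ulim_Rintegral (U : set_system nat) (UU : UltraFilter U)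
    (F : nat -> discrete G -> R) (M : R) :
  (forall n g, `|F n g| <= M) ->
  \int[tau]_g ulim U (F ^~ g) = ulim U (fun n => \int[tau]_g F n g).
Proof.
move=> FM; apply/esym/ulim_cvg.
have M0 : 0 <= M := le_trans (normr_ge0 _) (FM 0%N 1%g).
have LM g : `|ulim U (F ^~ g)| <= M by exact: ulim_norm.
have FU g : F ^~ g @ U --> ulim U (F ^~ g).
  by apply: (ultra_cvg UU); apply/bounded_byP; exists M.
apply/cvgrPdist_le => e e0.
(* An error [d] on [K], plus [M + M] on a complement of mass at most [d], must total at most [e]. *)
have [d d0 de] : exists2 d : R, 0 < d & d + (M + M) * d <= e.
  exists (e / (1 + (M + M))); first by rewrite divr_gt0// ltr_pwDl// addr_ge0.
  rewrite -[X in X + _]mul1r -mulrDl mulrC divfK// gt_eqF//.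
  by rewrite ltr_pwDl// addr_ge0.
have [K finK tK] := discrete_tail d0.
(* Pointwise convergence is uniform on the finite set [K], by induction on a list of its points. *)
have : \forall n \near U, forall g, K g -> `|ulim U (F ^~ g) - F n g| <= d.
  have := finK; rewrite finite_seqP => -[s ->].
  elim: s => [|a s IH]; first by apply: nearW => n g.
  have ha : \forall n \near U, `|ulim U (F ^~ a) - F n a| <= d.
    by have /cvgrPdist_le := FU a; apply.
  near=> n => g; rewrite /= inE => /predU1P[->|gs]; first by near: n.
  suff : forall g, g \in s -> `|ulim U (F ^~ g) - F n g| <= d by apply.
  by near: n.
apply: filterS => n hn.
(* [B] dominates the difference: [d] comes from uniformity on [K], and off [K] the trivial bound
   [M + M] is enough. *)
pose B g : R := d + (M + M) * \1_(~` K) g.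
have iF : tau.-integrable setT (EFin \o F n).
  by apply: bounded_integrable => //; apply/bounded_byP; exists M.
have iL : tau.-integrable setT (EFin \o (fun g => ulim U (F ^~ g))).
  by apply: bounded_integrable => //; apply/bounded_byP; exists M.
have i1 : tau.-integrable setT (EFin \o (fun g => (M + M) * \1_(~` K) g)).
  apply: bounded_integrable => //; apply/bounded_byP; exists (M + M) => g.
  rewrite indicE ger0_norm ?mulr_ge0 ?addr_ge0//.
  by rewrite ler_piMr ?addr_ge0//; case: (_ \in _).
have ic : tau.-integrable setT (EFin \o (fun _ : discrete G => d)).
  by apply: bounded_integrable => //; apply/bounded_byP; exists `|d|.
rewrite -RintegralB//.
have iD : tau.-integrable setT (EFin \o (fun g => ulim U (F ^~ g) - F n g)).
  apply: bounded_integrable => //; apply/bounded_byP; exists (M + M) => g.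
  by rewrite (le_trans (ler_normB _ _))// lerD.
rewrite (le_trans (le_normr_Rintegral _ _))//.
apply: (@le_trans _ _ (\int[tau]_g B g)).
  apply: le_Rintegral => //.
  - apply: bounded_integrable => //; apply/bounded_byP; exists (M + M) => g.
    by rewrite normr_id (le_trans (ler_normB _ _))// lerD.
  - apply: bounded_integrable => //; apply/bounded_byP;
    exists (d + (M + M)) => g.
    rewrite /B indicE ger0_norm ?addr_ge0 ?mulr_ge0 ?addr_ge0 ?(ltW d0)//.
    by rewrite lerD2l ler_piMr ?addr_ge0//; case: (_ \in _).
  - move=> g _; rewrite /B indicE; have [Kg|nKg] := pselect (K g).
      rewrite memNset ?mulr0 ?addr0; last by apply.
      exact: hn.
    rewrite mem_set// mulr1 (le_trans (ler_normB _ _))//.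
    by rewrite (le_trans (lerD (LM g) (FM n g)))// lerDr ltW.
rewrite /B RintegralD// Rintegral_cstT RintegralZl//; last first.
  apply: bounded_integrable => //; apply/bounded_byP; exists 1 => g.
  by rewrite indicE; case: (_ \in _); rewrite ?normr1 ?normr0.
rewrite (le_trans _ de)// lerD2l ler_wpM2l ?addr_ge0//.
by rewrite /Rintegral integral_indic ?setIT.
Unshelve. all: by end_near. Qed.

End discrete.

(** * The projection onto bounded harmonic functions *)

Section harmonic_projection.
Context (R : realType) (G : groupType) (tau : probability (discrete G) R).
Hypothesis Gcount : countable [set: G].
Implicit Types f : G -> R.

(** The Markov operator of the random walk with increments multiplied on the right; bounded harmonic
    functions are its bounded fixed points. *)
Definition step_mean f (g : G) : R := \int[tau]_h f (g * h)%g.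

Lemma step_mean_norm f (M : R) :
  (forall g, `|f g| <= M) -> forall g, `|step_mean f g| <= M.
Proof. by move=> fM g; apply: Rintegral_norm_le. Qed.

Lemma translate_integrable f (g : G) : bounded_fun f ->
  tau.-integrable setT (EFin \o (fun h : discrete G => f (g * h)%g)).
Proof.
move=> /bounded_byP[M fM]; apply: bounded_integrable => //.
by apply/bounded_byP; exists M.
Qed.

Lemma step_mean_linear a f f' g : bounded_fun f -> bounded_fun f' ->
  step_mean (fun x => a * f x + f' x) g = a * step_mean f g + step_mean f' g.
Proof.
move=> bf bf'; rewrite /step_mean RintegralD//; last 2 first.
- have [M fM] := (iffLR (bounded_byP f)) bf.
  apply: bounded_integrable => //; apply/bounded_byP; exists (`|a| * M) => h.
  by rewrite normrM ler_wpM2l.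
- exact: translate_integrable.
by rewrite RintegralZl//; exact: translate_integrable.
Qed.

Lemma step_mean_ge0 f : (forall g, 0 <= f g) -> forall g, 0 <= step_mean f g.
Proof. by move=> f0 g; apply: Rintegral_ge0. Qed.

Lemma step_mean_translate f k g :
  step_mean (fun x => f (k * x)%g) g = step_mean f (k * g)%g.
Proof. by congr fine; apply: eq_integral => h _; rewrite mulgA. Qed.

Local Notation P n f := (iter n step_mean f).

Lemma iter_step_norm f (M : R) n :
  (forall g, `|f g| <= M) -> forall g, `|P n f g| <= M.
Proof. by move=> fM; elim: n => //= n IH; exact: step_mean_norm. Qed.

Lemma iter_step_bounded f n : bounded_fun f -> bounded_fun (P n f).
Proof.
by move=> /bounded_byP[M fM]; apply/bounded_byP; exists M;
  exact: iter_step_norm.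
Qed.

Lemma iter_step_linear a f f' n g : bounded_fun f -> bounded_fun f' ->
  P n (fun x => a * f x + f' x) g = a * P n f g + P n f' g.
Proof.
move=> bf bf'; elim: n g => //= n IH g.
by rewrite (funext IH) step_mean_linear//; exact: iter_step_bounded.
Qed.

Lemma iter_step_ge0 f n : (forall g, 0 <= f g) -> forall g, 0 <= P n f g.
Proof. by move=> f0; elim: n => //= n IH; exact: step_mean_ge0. Qed.

Lemma iter_step_translate f k n g :
  P n (fun x => f (k * x)%g) g = P n f (k * g)%g.
Proof.
by elim: n g => //= n IH g; rewrite (funext IH) step_mean_translate.
Qed.

Definition cesaro f N g : R := N.+1%:R^-1 * \sum_(n < N.+1) P n f g.

Lemma cesaro_norm f (M : R) N :
  (forall g, `|f g| <= M) -> forall g, `|cesaro f N g| <= M.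
Proof.
move=> fM g; rewrite normrM gtr0_norm ?invr_gt0// mulrC ler_pdivrMr//.
rewrite (le_trans (ler_norm_sum _ _ _))//.
apply: (@le_trans _ _ (\sum_(n < N.+1) M)).
  by apply: ler_sum => n _; exact: iter_step_norm.
by rewrite sumr_const card_ord mulr_natr.
Qed.

(** The difference telescopes: only [P N.+1 f - f], divided by [N.+1], survives. *)
Lemma cesaro_step f (M : R) N g : (forall g, `|f g| <= M) ->
  `|step_mean (cesaro f N) g - cesaro f N g| <= N.+1%:R^-1 * (M + M).
Proof.
move=> fM.
have sumE m : step_mean (fun x => \sum_(n < m) P n f x) g =
    \sum_(n < m) P n.+1 f g.
  elim: m => [|m IH].
    rewrite big_ord0 /step_mean -[RHS](Rintegral_cstT tau).
    by congr fine; apply: eq_integral => h _; rewrite big_ord0.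
  have bP k : bounded_fun (P k f) by apply/iter_step_bounded/bounded_byP;
    exists M.
  have bS k : bounded_fun (fun x => \sum_(n < k) P n f x).
    apply/bounded_byP; exists (\sum_(n < k) M) => x.
    by rewrite (le_trans (ler_norm_sum _ _ _))// ler_sum// => n _;
      exact: iter_step_norm.
  rewrite big_ord_recr /= -IH -[X in X + _]mul1r -step_mean_linear//.
  by congr step_mean; apply/funext => x; rewrite big_ord_recr/= mul1r.
have -> : step_mean (cesaro f N) g = N.+1%:R^-1 * \sum_(n < N.+1) P n.+1 f g.
  rewrite -sumE /step_mean /cesaro RintegralZl//.
  apply: (@translate_integrable (fun x => \sum_(n < N.+1) P n f x)).
  apply/bounded_byP.
  exists (\sum_(n < N.+1) M) => x.
  by rewrite (le_trans (ler_norm_sum _ _ _))// ler_sum// => n _;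
    exact: iter_step_norm.
rewrite -mulrBr normrM gtr0_norm ?invr_gt0// ler_wpM2l ?invr_ge0//.
rewrite big_ord_recr/= [X in _ - X]big_ord_recl/= /bump/=.
set S := \sum_(i < N) _.
have -> : S + P N.+1 f g - (f g + S) = P N.+1 f g - f g by ring.
rewrite (le_trans (ler_normB _ _))// lerD//.
exact: (@iter_step_norm f M N.+1 fM).
Qed.

Lemma free_ultrafilter_exists :
  exists U : set_system nat, UltraFilter U /\ \oo `<=` U.
Proof. exact: ultraFilterLemma. Qed.

(** It refines the filter [\oo], so ordinary limits at infinity are also limits along it. *)
Definition free_ultrafilter : set_system nat := sval (cid
  free_ultrafilter_exists).

#[local] Instance free_ultrafilter_ultra : UltraFilter free_ultrafilter.
Proof. by case: (svalP (cid free_ultrafilter_exists)). Qed.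

Lemma free_ultrafilter_oo : \oo `<=` free_ultrafilter.
Proof. by case: (svalP (cid free_ultrafilter_exists)). Qed.

(** This is the projection E. Linearity comes from using one and the same ultrafilter for all
    functions and all points. *)
Definition harmonic_proj f g : R := ulim free_ultrafilter (cesaro f ^~ g).

Lemma cesaro_bounded f g : bounded_fun f -> bounded_fun (cesaro f ^~ g).
Proof.
by move=> /bounded_byP[M fM]; apply/bounded_byP; exists M => N;
  exact: cesaro_norm.
Qed.

Lemma harmonic_proj_norm f (M : R) :
  (forall g, `|f g| <= M) -> forall g, `|harmonic_proj f g| <= M.
Proof. by move=> fM g; apply: ulim_norm => N; exact: cesaro_norm. Qed.

Lemma harmonic_proj_linear a f f' g : bounded_fun f -> bounded_fun f' ->
  harmonic_proj (fun x => a * f x + f' x) g =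
  a * harmonic_proj f g + harmonic_proj f' g.
Proof.
move=> bf bf'; rewrite -ulim_linear; [|exact: cesaro_bounded..].
congr ulim; apply/funext => N;
  rewrite /cesaro mulrCA -mulrDr [a * _]mulr_sumr -big_split/=.
by congr (_ * _); apply: eq_bigr => n _; rewrite iter_step_linear.
Qed.

Lemma harmonic_proj_ge0 f : bounded_fun f -> (forall g, 0 <= f g) ->
  forall g, 0 <= harmonic_proj f g.
Proof.
move=> bf f0 g; apply: ulim_ge; first exact: cesaro_bounded.
by move=> N; rewrite mulr_ge0 ?invr_ge0// sumr_ge0// => n _;
  exact: iter_step_ge0.
Qed.

Lemma harmonic_proj_le f f' : bounded_fun f -> bounded_fun f' ->
  (forall g, f g <= f' g) -> forall g, harmonic_proj f g <= harmonic_proj f' g.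
Proof.
move=> bf bf' ff' g; rewrite -subr_ge0 addrC -mulN1r -harmonic_proj_linear//.
apply: harmonic_proj_ge0 => [|x]; last by rewrite mulN1r addrC subr_ge0.
have [M fM] := iffLR (bounded_byP f) bf.
have [M' fM'] := iffLR (bounded_byP f') bf'.
apply/bounded_byP; exists (M + M') => x.
by rewrite mulN1r (le_trans (ler_normD _ _))// normrN lerD.
Qed.

(** [ulim_Rintegral] moves the integral inside the ultralimit; by [cesaro_step], one more step of
    the walk changes the Cesaro means by a term of order [1 / N], which vanishes along the
    ultrafilter. *)
Lemma harmonic_proj_harmonic f :
  bounded_fun f -> bounded_harmonic tau (harmonic_proj f).
Proof.
move=> bf; have [M fM] := iffLR (bounded_byP f) bf.
split=> [|g]; first by apply/bounded_byP; exists M; exact: harmonic_proj_norm.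
rewrite (@ulim_Rintegral R G tau Gcount _ _ (fun N h => cesaro f N (g * h)%g)
  M);
  last by move=> N h; exact: cesaro_norm.
have cg : cesaro f ^~ g @ free_ultrafilter --> harmonic_proj f g.
  by apply: ultra_cvg; exact: cesaro_bounded.
apply/esym/ulim_cvg.
rewrite -[X in _ --> X]addr0 [X in X @ _](_ : _ = (fun N => cesaro f N g +
    (step_mean (cesaro f N) g - cesaro f N g))); last first.
  by apply/funext => N; rewrite addrC subrK.
apply: cvgD => //; apply: norm_cvg0.
have e0 : (fun N => N.+1%:R^-1 * (M + M)) @ \oo --> (0 : R).
  rewrite -[X in _ --> X](mul0r (M + M)); apply: cvgM; last exact: cvg_cst.
  exact: cvg_harmonic.
have {e0} : (fun N => N.+1%:R^-1 * (M + M)) @ free_ultrafilter --> (0 : R).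
  by apply: cvg_trans e0 => V; exact: free_ultrafilter_oo.
apply: (@squeeze_cvgr _ _ _ _ (fun=> 0)) => //.
- by apply: nearW => N; rewrite normr_ge0 /=; exact: cesaro_step.
- exact: cvg_cst.
Qed.

Lemma harmonic_proj_id f : bounded_harmonic tau f -> harmonic_proj f = f.
Proof.
move=> [bf fh]; have Pf n : P n f = f.
  by elim: n => //= n ->; apply/funext => g; rewrite [RHS]fh.
apply/funext => g; apply: ulim_cvg.
rewrite [X in X @ _](_ : _ = fun=> f g); first exact: cvg_cst.
apply/funext => N; rewrite /cesaro (eq_bigr (fun=> f g)) => [|n _];
  last by rewrite Pf.
by rewrite sumr_const card_ord -[f g *+ _]mulr_natl mulrA mulVf// mul1r.
Qed.

Lemma harmonic_proj_translate f k g :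
  harmonic_proj (fun x => f (k * x)%g) g = harmonic_proj f (k * g)%g.
Proof.
congr ulim; apply/funext => N; congr (_ * _); apply: eq_bigr => n _.
exact: iter_step_translate.
Qed.

Lemma harmonic_proj_cst (c : R) g : harmonic_proj (fun=> c) g = c.
Proof.
rewrite harmonic_proj_id//; split=> [|h]; last by rewrite Rintegral_cstT.
by apply/bounded_byP; exists `|c|.
Qed.

End harmonic_projection.

(** * Measures on the discrete group, cosets and the absorbing property *)

Lemma eq_pushforward_Rintegral d d' (X : measurableType d)
    (Y : measurableType d') (R : realType) (P : probability X R)
    (phi psi : X -> Y) (f : Y -> R) :
  measurable_fun setT phi -> measurable_fun setT psi ->
  measurable_fun setT f -> bounded_fun f ->
  (forall A, measurable A -> P (phi @^-1` A) = P (psi @^-1` A)) ->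
  \int[P]_x f (phi x) = \int[P]_x f (psi x).
Proof.
move=> mphi mpsi mf /bounded_byP[M fM] eqP.
have transfer u : measurable_fun setT u ->
    (\int[P]_x (f (u x))%:E = \int[pushforward P u]_y (f y)%:E)%E.
  move=> mu; rewrite (integral_pushforward mu)//; first exact/measurable_EFinP.
  apply: (@bounded_integrable _ _ _ P (f \o u)); first exact: measurableT_comp.
  by apply/bounded_byP; exists M => x; exact: fM.
rewrite /Rintegral !transfer//; congr fine.
by apply: eq_measure_integral => A mA _; exact: eqP.
Qed.

Section discrete_measures.
Context (R : realType) (G : groupType).
Hypothesis Gcount : countable [set: G].

(** An injection into [nat] cuts [A] into countably many pieces with at most one point each, to
    which countable additivity applies. *)
Lemma discrete_preimage_esum (mu : {measure set (discrete G) -> \bar R})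
    (phi : G -> G) (A : set G) :
  mu (phi @^-1` A) = (\esum_(g in A) mu (phi @^-1` [set g]))%E.
Proof.
have /countable_injP[c cinj] := Gcount.
pose F n := A `&` [set g | c g = n].
have AF : A = \bigcup_(n in setT) F n.
  apply/seteqP; split=> [g Ag|g [n _ []]//].
  by exists (c g).
have tF : trivIset setT F.
  by apply/trivIsetP => i j _ _ /eqP ij; apply/seteqP;
    split => // g [[_ /= gi] [_ /= gj]]; case: ij; rewrite -gi.
have F1 n : F n = set0 \/ exists g, F n = [set g].
  have [->|/set0P[g [Ag cg]]] := eqVneq (F n) set0; first by left.
  right; exists g; apply/seteqP; split => [h [Ah ch]|_ ->//].
  by apply: cinj; rewrite ?ch ?cg//; apply/mem_set.
rewrite [in LHS]AF preimage_bigcup measure_bigcup//; last first.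
  by apply/trivIsetP => i j _ _ ij;
    rewrite -preimage_setI (iffLR trivIsetP tF)// preimage_set0.
rewrite [in RHS]AF esum_bigcupT//.
rewrite (eq_eseriesl (Q := xpredT)) => [|n]; last by rewrite in_setT.
rewrite nneseries_esumT//; apply: eq_esum => n _.
have [->|[g ->]] := F1 n; first by rewrite preimage_set0 measure0 esum_set0.
by rewrite esum_set1.
Qed.

Lemma discrete_preimage_eq (mu : {measure set (discrete G) -> \bar R})
    (phi psi : G -> G) :
  (forall g, mu (phi @^-1` [set g]) = mu (psi @^-1` [set g])) ->
  forall A, mu (phi @^-1` A) = mu (psi @^-1` A).
Proof.
move=> munu A; rewrite !discrete_preimage_esum.
by apply: eq_esum => g _; exact: munu.
Qed.
End discrete_measures.

Section cosets.
Context (G : groupType) (L : groupClosed G).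

Definition right_invariant (T : Type) (f : G -> T) :=
  forall g l, l \in L -> f (g * l)%g = f g.

(** The set contains [g], so the default [1] never serves as a fallback. The chosen element depends
    only on the coset of [g], which lets functions on the coset space be handled as functions on the
    group. *)
Definition coset_repr (g : G) : G := xget 1%g [set x : G | (g^-1 * x)%g \in L].

Lemma coset_repr_mem g : (g^-1 * coset_repr g)%g \in L.
Proof. by rewrite /coset_repr; case: xgetP => // /(_ g);
  rewrite /= mulVg gpred1. Qed.

Lemma coset_repr_invariant : right_invariant coset_repr.
Proof.
move=> g l lL; have lVL : (l^-1)%g \in L by rewrite gpredV.
congr xget; apply/seteqP; split => x /=.
  by rewrite invgM -mulgA (gpredMl (g^-1 * x)%g lVL).
by rewrite invgM -mulgA (gpredMl (g^-1 * x)%g lVL).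
Qed.

Lemma right_invariant_repr (T : Type) (f : G -> T) g :
  right_invariant f -> f (coset_repr g) = f g.
Proof.
by move=> fL; rewrite -(mulVKg g (coset_repr g)) fL//; exact: coset_repr_mem.
Qed.

End cosets.

Section absorbing.
Context (R : realType) (G : groupType) (L : groupClosed G).
Context (tau : probability (discrete G) R).
Hypothesis Gcount : countable [set: G].
Hypothesis tauL : absorbing L tau.

Lemma coset_massE g : coset_mass L tau g = tau (translate g [set` L]).
Proof.
rewrite -[translate _ _]preimage_id (discrete_preimage_esum Gcount tau id)
  /translate esum_image//.
by move=> x y _ _; exact: mulgI.
Qed.

(** The fibre over a representative [r] of the map sending [h] to the representative of [k * h] is
    the coset of [k^-1 * r]. Absorption says that the cosets of [l^-1 * r] and of [r] have equal
    mass. *)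
Lemma absorbing_translate l (r : G) : l \in L ->
  tau [set h | coset_repr L (l * h)%g = r] = tau [set h | coset_repr L h = r].
Proof.
(* If [r] is not the chosen representative of its own coset, both fibres are empty. *)
move=> lL; have [rr|nr] := eqVneq (coset_repr L r) r; last first.
  suff h0 (u : G -> G) : [set h | coset_repr L (u h) = r] = set0.
    by rewrite (h0 (fun h => l * h)%g) (h0 id).
  apply/seteqP; split => // h /= hr; case/eqP: nr.
  by rewrite -[in LHS]hr (@right_invariant_repr _ L _ (coset_repr L) (u h)
    (@coset_repr_invariant _ L)).
have fibre (k : G) : [set h | coset_repr L (k * h)%g = r] =
    translate (k^-1 * r)%g [set` L].
  apply/seteqP; split => [h /= <-|_ [x /= xL <-]].
    exists ((coset_repr L (k * h))^-1 * (k * h))%g;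
      last by rewrite -mulgA mulVKg mulKg.
    by rewrite /= -gpredV invgM invgK; exact: coset_repr_mem.
  by rewrite mulgA mulVKg coset_repr_invariant.
have -> : [set h | coset_repr L h = r] = [set h | coset_repr L (1 * h)%g = r].
  by apply/seteqP; split => h /=; rewrite mul1g.
by rewrite !fibre invg1 mul1g -!coset_massE tauL// gpredV.
Qed.

(** The integrand at [g * l] is [F] at [l * h]. As [F] depends only on the coset of its argument, it
    suffices that, for [h] of law [tau], the cosets of [l * h] and of [h] have the same law. *)
Lemma step_mean_invariant (f : G -> R) : bounded_fun f ->
  right_invariant L f -> right_invariant L (step_mean tau f).
Proof.
move=> bf fL g l lL; rewrite /step_mean.
pose F (h : discrete G) : R := f (g * h)%g.
have FL h : F (coset_repr L h) = F h.
  by rewrite (@right_invariant_repr _ L _ F)// => x y yL; rewrite /F mulgA;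
    exact: fL.
transitivity (\int[tau]_h F (coset_repr L (l * h)%g)).
  by congr fine; apply: eq_integral => h _; rewrite FL /F mulgA.
transitivity (\int[tau]_h F (coset_repr L h)); last first.
  by congr fine; apply: eq_integral => h _; rewrite FL.
have [M fM] := iffLR (bounded_byP f) bf.
apply: (@eq_pushforward_Rintegral _ _ (discrete G) (discrete G) R tau
  (fun h => coset_repr L (l * h)%g) (coset_repr L) F) => //.
  by apply/bounded_byP; exists M => h; exact: fM.
move=> A _; apply: (discrete_preimage_eq Gcount) => r.
exact: absorbing_translate.
Qed.

Lemma harmonic_proj_invariant (f : G -> R) : bounded_fun f ->
  right_invariant L f -> right_invariant L (harmonic_proj tau f).
Proof.
move=> bf fL g l lL; congr ulim; apply/funext => N; congr (_ * _).
apply: eq_bigr => n _.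
suff : right_invariant L (iter n (step_mean tau) f) by apply.
elim: (nat_of_ord n) => //= m IH.
by apply: step_mean_invariant => //; exact: iter_step_bounded.
Qed.

End absorbing.

(** * Invariant means *)

Section means.
Context (R : realType) (G : groupType) (L : groupClosed G).
Context (tau : probability (discrete G) R).
Hypothesis Gcount : countable [set: G].

Lemma harmonic_proj_mean (T : Type) (D : set T) (u : G -> T) :
  (forall g, D (u g)) ->
  is_mean D (fun F : T -> R => harmonic_proj tau (F \o u) 1%g).
Proof.
move=> Du; have bu (F : T -> R) : [bounded F x | x in D] -> bounded_fun (F \o
  u).
  move=> /boundedP[M FM]; apply/bounded_byP; exists M => g; exact/FM/Du.
split.
- by move=> F F' FF'; congr harmonic_proj; apply/funext => g; exact: FF'.
- by move=> a F F' bF bF'; rewrite -harmonic_proj_linear//; exact: bu.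
- by move=> F bF F0; apply: harmonic_proj_ge0 => [|g]; [exact: bu|exact/F0/Du].
- exact: harmonic_proj_cst.
Qed.

(** A function on [L] is pulled back to the group, projected and evaluated at 1. Left translation by
    [l] moves the evaluation point to [l^-1], which is also a right translate of 1, so right
    invariance applies. *)
Lemma amenable_of_invariant_harmonic :
  (forall phi, bounded_harmonic tau phi -> right_invariant L phi) ->
  amenable R L.
Proof.
(* As [coset_repr L g^-1] lies in the coset of [g^-1], [s] takes values in [L]; as it depends only
   on that coset, [s] is equivariant for left multiplication by [L]. *)
move=> inv; pose s (g : G) := (g * coset_repr L g^-1)%g.
have sL g : s g \in L by rewrite /s -{1}[g]invgK; exact: coset_repr_mem.
exists (fun F => harmonic_proj tau (F \o s) 1%g).
  exact: harmonic_proj_mean.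
move=> l F lL /boundedP[M FM].
have bF : bounded_fun (F \o s).
  by apply/bounded_byP; exists M => g; exact/FM/sL.
have slg g : s (l^-1 * g)%g = (l^-1 * s g)%g.
  by rewrite /s invgM invgK coset_repr_invariant// mulgA.
rewrite [X in harmonic_proj _ X](_ : _ = (fun g => (F \o s) (l^-1 * g)%g)).
  have lVL : (l^-1)%g \in L by rewrite gpredV.
  have := inv _ (harmonic_proj_harmonic tau Gcount bF) 1%g _ lVL.
  by rewrite harmonic_proj_translate mulg1 mul1g.
by apply/funext => g; rewrite /= slg.
Qed.

(** A function on the coset space pulls back to a right [L]-invariant function; its projection is
    harmonic and still right [L]-invariant, hence constant, and translating it does not change its
    value at 1. *)
Lemma coamenable_of_constant_harmonic : absorbing L tau ->
  (forall phi, bounded_harmonic tau phi -> right_invariant L phi ->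
    forall g, phi g = phi 1%g) ->
  coamenable R L.
Proof.
move=> tauL cst; pose u (g : G) : set G := translate g [set` L].
have uD g : coset_space L (u g) by exists g.
exists (fun F => harmonic_proj tau (F \o u) 1%g).
  exact: harmonic_proj_mean.
move=> k F _ /boundedP[M FM].
have bF : bounded_fun (F \o u).
  by apply/bounded_byP; exists M => g; exact/FM/uD.
have uk g : translate k^-1 (u g) = u (k^-1 * g)%g.
  apply/seteqP; split => [_ [_ [x xL <-] <-]|_ [x xL <-]].
    by exists x => //; rewrite mulgA.
  by exists (g * x)%g; [exists x|rewrite mulgA].
have uL : right_invariant L (F \o u).
  move=> g l lL /=; congr F; apply/seteqP; split => [_ [x xL <-]|_ [x xL <-]].
    by exists (l * x)%g; [rewrite /= gpredM|rewrite mulgA].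
  exists (l^-1 * x)%g; last by rewrite -mulgA mulVKg.
  by rewrite /= gpredM// gpredV.
rewrite [X in harmonic_proj _ X](_ : _ = (fun g => (F \o u) (k^-1 * g)%g)).
  rewrite harmonic_proj_translate; apply: cst.
    exact: harmonic_proj_harmonic.
  exact: harmonic_proj_invariant.
by apply/funext => g; rewrite /= uk.
Qed.

End means.

(** * Everywhere bounded measurable functions, as representatives of essentially bounded ones *)

Section bounded_measurable.
Context d (X : measurableType d) (R : realType).
Implicit Types f : X -> R.

Definition bounded_measurable f := measurable_fun setT f /\ bounded_fun f.

Lemma bounded_measurable_cst (c : R) : bounded_measurable (fun=> c).
Proof. by split => //; apply/bounded_byP; exists `|c|. Qed.

Lemma bounded_measurable_indic (A : set X) :
  measurable A -> bounded_measurable (\1_A : X -> R).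
Proof.
move=> mA; split; first exact: measurable_indic.
by apply/bounded_byP; exists 1 => x; rewrite indicE; case: (_ \in _);
  rewrite ?normr1 ?normr0.
Qed.

Lemma bounded_measurable_linear (a : R) f f' :
  bounded_measurable f -> bounded_measurable f' ->
  bounded_measurable (fun x => a * f x + f' x).
Proof.
move=> [mf /bounded_byP[M fM]] [mf' /bounded_byP[M' fM']]; split.
  by apply: measurable_funD => //; exact: measurable_funM.
apply/bounded_byP; exists (`|a| * M + M') => x.
by rewrite (le_trans (ler_normD _ _))// lerD// normrM ler_wpM2l.
Qed.

Lemma bounded_measurable_max f f' :
  bounded_measurable f -> bounded_measurable f' ->
  bounded_measurable (fun x => Num.max (f x) (f' x)).
Proof.
move=> [mf /bounded_byP[M fM]] [mf' /bounded_byP[M' fM']]; split.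
  exact: measurable_maxr.
apply/bounded_byP; exists (Num.max M M') => x.
by rewrite le_max /Num.max; case: ifP; rewrite ?fM ?fM' ?orbT.
Qed.

Lemma bounded_measurable_comp d' (Y : measurableType d') (u : Y -> X) f :
  measurable_fun setT u -> bounded_measurable f ->
  measurable_fun setT (f \o u) /\ bounded_fun (f \o u).
Proof.
move=> mu [mf /bounded_byP[M fM]]; split; first exact: measurableT_comp.
by apply/bounded_byP; exists M => x; exact: fM.
Qed.

Lemma bounded_measurable_Lfun (P : probability X R) f :
  bounded_measurable f -> f \in Lfun P +oo%E.
Proof.
move=> [mf /bounded_byP[M fM]]; apply/andP; split; rewrite inE//=.
rewrite /finite_norm unlock /= (probability_setT P) lte01.
apply: (@le_lt_trans _ _ M%:E); last by rewrite ltry.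
by apply/ess_supP; apply: nearW => x; rewrite /= lee_fin.
Qed.

End bounded_measurable.

(** * The order structure of the Poisson transform *)

Section poisson_transform.
Context (R : realType) (G : groupType) (tau : probability (discrete G) R).
Context (B : gspace R G).
Hypothesis BP : poisson_boundary tau B.
Implicit Types f : B -> R.
Local Notation nu := (glaw B).
Local Notation tr := poisson_transform.

Lemma boundary_action : is_action (@gact R G B).
Proof. by case: (poisson_is_boundary BP) => -[]. Qed.

Lemma boundary_measurable g : measurable_fun setT (@gact R G B g).
Proof. by case: (poisson_is_boundary BP) => -[]. Qed.

Lemma gact_integrable f g : bounded_measurable f ->
  nu.-integrable setT (EFin \o (fun b => f (gact g b))).
Proof.
move=> /(bounded_measurable_comp (boundary_measurable g))[mf bf].
exact: bounded_integrable.
Qed.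

Lemma transform_linear (a : R) f f' g :
  bounded_measurable f -> bounded_measurable f' ->
  tr (fun x => a * f x + f' x) g = a * tr f g + tr f' g.
Proof.
move=> bf bf'; rewrite /tr RintegralD//; last exact: gact_integrable.
  by rewrite RintegralZl//; exact: gact_integrable.
have := gact_integrable g (bounded_measurable_linear a bf
  (bounded_measurable_cst _ 0)).
by congr integrable; apply/funext => b /=; rewrite addr0.
Qed.

Lemma transform_cst (c : R) g : tr (fun _ : B => c) g = c.
Proof. exact: Rintegral_cstT. Qed.

Lemma transform_le f f' g : bounded_measurable f -> bounded_measurable f' ->
  (forall x, f x <= f' x) -> tr f g <= tr f' g.
Proof.
by move=> bf bf' ff'; apply: le_Rintegral => //; exact: gact_integrable.
Qed.

Lemma measurable_gact_preimage (A : set B) (g : G) :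
  measurable A -> measurable (gact g @^-1` A).
Proof.
by move=> mA; rewrite -[X in measurable X]setTI; exact: boundary_measurable.
Qed.

Lemma transform_indic (A : set B) g : measurable A ->
  tr (\1_A : B -> R) g = fine (nu (gact g @^-1` A)).
Proof.
move=> mA; congr fine.
rewrite -[in RHS](setIT (gact g @^-1` A)) -integral_indic//.
exact: measurable_gact_preimage.
Qed.

Lemma transform_isometry f : bounded_measurable f ->
  ereal_sup (range (fun g : G => `|tr f g|%:E)) =
  ess_sup nu (fun x => `|f x|%:E).
Proof.
move=> bf; rewrite (poisson_isometry BP); last exact: bounded_measurable_Lfun.
by rewrite unlock /= (probability_setT nu) lte01.
Qed.

(** Quasi-invariance of [nu] follows from the isometry: the indicator of a null set has norm 0, so
    its transform vanishes at every [g]. *)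
Lemma transform_null (A : set B) g :
  measurable A -> nu A = 0%E -> nu (gact g @^-1` A) = 0%E.
Proof.
move=> mA A0; have h := transform_isometry (bounded_measurable_indic R mA).
have : (`|tr (\1_A : B -> R) g|%:E <= 0)%E.
  apply: (@le_trans _ _ (ereal_sup (range (fun g : G => `|tr (\1_A : B -> R)
    g|%:E)))).
    by apply: ereal_sup_ubound; exists g.
  rewrite h; apply/ess_supP; exists A; split => // x /=.
  apply: contra_notP => nA; rewrite indicE memNset//.
  by rewrite normr0.
rewrite lee_fin normr_le0 transform_indic// => /eqP nuA.
by rewrite -[LHS]fineK ?nuA// fin_num_measure//;
  exact: measurable_gact_preimage.
Qed.

Lemma ae_gact (Q : B -> Prop) g :
  {ae nu, forall x, Q x} -> {ae nu, forall x, Q (gact g x)}.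
Proof.
move=> [N [mN N0 QN]]; exists (gact g @^-1` N); split.
- exact: measurable_gact_preimage.
- exact: transform_null.
- by move=> x /= nQ; apply: QN.
Qed.

Lemma transform_ae_eq f f' g : measurable_fun setT f -> measurable_fun setT f'
  ->
  {ae nu, forall x, f x = f' x} -> tr f g = tr f' g.
Proof.
move=> mf mf' ff'; congr fine; apply: ae_eq_integral => //.
- by apply/measurable_EFinP/measurableT_comp => //; exact: boundary_measurable.
- by apply/measurable_EFinP/measurableT_comp => //; exact: boundary_measurable.
- by have := ae_gact g ff'; apply: filterS => x -> .
Qed.

(** Replacing [f'] by the maximum makes the inequality hold everywhere and changes [f'] only on a
    null set. *)
Lemma transform_ae_le f f' g : bounded_measurable f -> bounded_measurable f' ->
  {ae nu, forall x, f x <= f' x} -> tr f g <= tr f' g.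
Proof.
move=> bf bf' ff'; have bm := bounded_measurable_max bf bf'.
rewrite (@transform_ae_eq f' (fun x => Num.max (f x) (f' x))).
- by apply: transform_le => // x; rewrite le_max lexx.
- by case: bf'.
- by case: bm.
- by apply: filterS ff' => x /max_idPr ->.
Qed.

(* With d := f' - f and |d| <= M, the transform of M - d takes values in [0, M], so
   by isometry |M - d| <= M almost everywhere. *)
Lemma transform_order f f' : bounded_measurable f -> bounded_measurable f' ->
  (forall g, tr f g <= tr f' g) -> {ae nu, forall x, f x <= f' x}.
Proof.
move=> bf bf' trff'.
pose d x := -1 * f x + f' x; have bd := bounded_measurable_linear (-1) bf bf'.
have d0 g : 0 <= tr d g by rewrite transform_linear// mulN1r addrC subr_ge0.
have [M dM] : exists M : R, forall x, `|d x| <= M by case: bd => _ /bounded_byP.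
have M0 : 0 <= M by rewrite (le_trans _ (dM point)).
pose e x := -1 * d x + M.
have be : bounded_measurable e := bounded_measurable_linear (-1) bd
  (bounded_measurable_cst _ M).
have e0 g : 0 <= tr e g.
  rewrite -(transform_cst 0 g); apply: transform_le => //.
    exact: bounded_measurable_cst.
  by move=> x; rewrite /e mulN1r addrC subr_ge0 (le_trans (ler_norm _)).
have : (ess_sup nu (fun x => `|e x|%:E) <= M%:E)%E.
  rewrite -transform_isometry//; apply: ge_ereal_sup => _ [g _ <-].
  rewrite lee_fin ger0_norm// transform_linear//;
    last exact: bounded_measurable_cst.
  by rewrite transform_cst mulN1r gerDr oppr_le0.
move=> /ess_supP; apply: filterS => x; rewrite lee_fin /e mulN1r => h.
have := le_trans (ler_norm _) h.
by rewrite gerDr oppr_le0 /d mulN1r addrC subr_ge0.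
Qed.

Lemma transform_harmonic f :
  bounded_measurable f -> bounded_harmonic tau (tr f).
Proof. by move=> bf; apply: (poisson_harmonic BP);
  exact: bounded_measurable_Lfun. Qed.

(** The preimage given by surjectivity is only essentially bounded; clamping it alters it on a null
    set, which the transform does not see. *)
Lemma transform_onto phi : bounded_harmonic tau phi ->
  exists2 f : B -> R, bounded_measurable f & tr f = phi.
Proof.
move=> /(poisson_onto BP)[f fL <-].
have mf : measurable_fun setT f by move: (sub_Lfun_mfun fL); rewrite inE.
have [M fM] : exists M : R, {ae nu, forall x, `|f x| <= M}.
  move: (sub_Lfun_finLfun fL); rewrite inE /= /finite_norm unlock /=.
  rewrite (probability_setT nu) lte01 => /ess_supr_bounded[M hM].
  by exists M.
(* This clamps [f] to the interval from [- |M|] to [|M|], the inner part being the minimum of [|M|]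
   and [f]. Using [|M|] avoids proving that [M] is nonnegative. *)
pose c (x : B) : R := Num.max (- `|M|) (- Num.max (- `|M|) (- f x)).
have mc : measurable_fun setT c.
  by apply: measurable_maxr => //; apply: measurable_funN;
    apply: measurable_maxr => //; apply: measurable_funN; exact: mf.
exists c.
  split=> //; apply/bounded_byP; exists `|M| => x; rewrite ler_norml /c/=.
  rewrite le_max lexx/= ge_max.
  apply/andP; split; first by rewrite (@le_trans _ _ 0)// oppr_le0.
  by rewrite lerNl le_max lexx.
apply/funext => g; apply: transform_ae_eq => //.
apply: filterS fM => x fM.
have : `|f x| <= `|M| by rewrite (le_trans fM)// ler_norm.
rewrite ler_norml /c => /andP[h1 h2].
have -> : Num.max (- `|M|) (- f x) = - f x by apply/max_idPr; rewrite lerN2.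
by rewrite opprK; apply/max_idPr.
Qed.

End poisson_transform.

(** * The invariant sigma-algebra *)

Section invariant_algebra.
Context (R : realType) (G : groupType) (L : groupClosed G).
Context (tau : probability (discrete G) R) (B : gspace R G).
Hypothesis Gcount : countable [set: G].
Hypothesis tauL : absorbing L tau.
Hypothesis BP : poisson_boundary tau B.
Implicit Types f : B -> R.
Local Notation nu := (glaw B).
Local Notation tr := (@poisson_transform R G B).
Local Notation proj := (harmonic_proj tau).

(** Let [k] have as transform the projection of [u], the maximum of the two transforms. By
    [transform_order], [k] dominates both functions almost everywhere, which gives one inequality.
    Conversely, the transform of the maximum is a harmonic function above [u], and the projection is
    monotone and fixes it. *)
Lemma transform_max f f' : bounded_measurable f -> bounded_measurable f' ->
  tr (fun x => Num.max (f x) (f' x)) =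
  proj (fun g => Num.max (tr f g) (tr f' g)).
Proof.
move=> bf bf'; have bm := bounded_measurable_max bf bf'.
have [hf _] := transform_harmonic BP bf.
have [hf' _] := transform_harmonic BP bf'.
have hm := transform_harmonic BP bm.
pose u g := Num.max (tr f g) (tr f' g).
have bu : bounded_fun u.
  have [M fM] := iffLR (bounded_byP _) hf.
  have [M' fM'] := iffLR (bounded_byP _) hf'.
  apply/bounded_byP; exists (Num.max M M') => g.
  by rewrite le_max /u /Num.max; case: ifP; rewrite ?fM ?fM' ?orbT.
have [k bk trk] := transform_onto BP (harmonic_proj_harmonic tau Gcount bu).
have fk h : bounded_measurable h -> (forall g, tr h g <= u g) ->
    {ae nu, forall x, h x <= k x}.
  move=> bh hu; apply: (transform_order BP) => // g.
  rewrite trk -[leLHS](congr1 (fun v => v g) (harmonic_proj_id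
    (transform_harmonic BP bh))).
  by apply: harmonic_proj_le => //; case: (transform_harmonic BP bh).
apply/funext => g; apply/eqP; rewrite eq_le; apply/andP; split.
  rewrite -/u -trk; apply: (transform_ae_le BP) => //.
  near=> x; rewrite ge_max; apply/andP; split.
    near: x; apply: fk => // h; rewrite /u le_max lexx//.
  by near: x; apply: fk => // h; rewrite /u le_max lexx orbT.
rewrite -[leRHS](congr1 (fun v => v g) (harmonic_proj_id hm)).
apply: harmonic_proj_le => //; first by case: hm.
move=> h; rewrite ge_max; apply/andP; split; apply: (transform_le BP) => // x.
  by rewrite le_max lexx.
by rewrite le_max lexx orbT.
Unshelve. all: by end_near. Qed.

Definition invariant_fun f := bounded_measurable f /\ right_invariant L (tr f).

Lemma invariant_fun_max f f' : invariant_fun f -> invariant_fun f' ->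
  invariant_fun (fun x => Num.max (f x) (f' x)).
Proof.
move=> [bf If] [bf' If']; split; first exact: bounded_measurable_max.
rewrite transform_max//; apply: harmonic_proj_invariant => //.
  have [hf _] := transform_harmonic BP bf.
  have [hf' _] := transform_harmonic BP bf'.
  have [M fM] := iffLR (bounded_byP _) hf.
  have [M' fM'] := iffLR (bounded_byP _) hf'.
  apply/bounded_byP; exists (Num.max M M') => g.
  by rewrite le_max /Num.max; case: ifP; rewrite ?fM ?fM' ?orbT.
by move=> g l lL; rewrite If// If'.
Qed.

Lemma invariant_fun_linear (a : R) f f' :
  invariant_fun f -> invariant_fun f' -> invariant_fun (fun x => a * f x + f'
    x).
Proof.
move=> [bf If] [bf' If']; split; first exact: bounded_measurable_linear.
by move=> g l lL; rewrite !(transform_linear BP)// If// If'.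
Qed.

Lemma invariant_fun_cst (c : R) : invariant_fun (fun=> c).
Proof.
split; first exact: bounded_measurable_cst.
by move=> g l lL; rewrite !transform_cst.
Qed.

(** These sets form the sigma-algebra S. Using measures instead of transforms makes complements and
    increasing unions immediate. *)
Definition invariant_set (A : set B) :=
  measurable A /\ right_invariant L (fun g => nu (gact g @^-1` A)).

Lemma invariant_setP (A : set B) : measurable A ->
  invariant_set A <-> invariant_fun (\1_A : B -> R).
Proof.
move=> mA; have fin g : nu (gact g @^-1` A) \is a fin_num.
  by rewrite fin_num_measure//; exact: (measurable_gact_preimage BP).
split=> [[_ IA]|[_ IA]]; split=> //.
- exact: bounded_measurable_indic.
- by move=> g l lL; rewrite !(transform_indic BP)// IA.
- move=> g l lL; apply/eqP; rewrite -[eqbLHS]fineK// -[eqbRHS]fineK// eqe.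
  by rewrite -!(transform_indic BP)// IA.
Qed.

Lemma invariant_set0 : invariant_set set0.
Proof. by split => // g l lL; rewrite !preimage_set0. Qed.

Lemma invariant_setC (A : set B) : invariant_set A -> invariant_set (~` A).
Proof.
move=> [mA IA]; split; first exact: measurableC.
have compl g : nu (gact g @^-1` (~` A)) = (1 - nu (gact g @^-1` A))%E.
  rewrite -preimage_setC; apply: probability_setC.
  exact: (measurable_gact_preimage BP).
by move=> g l lL; rewrite !compl IA.
Qed.

(** The indicator of a union is the maximum of the indicators. *)
Lemma invariant_setU (A A' : set B) :
  invariant_set A -> invariant_set A' -> invariant_set (A `|` A').
Proof.
move=> IA IA'; have [mA _] := IA; have [mA' _] := IA'.
apply/invariant_setP; first exact: measurableU.
have := invariant_fun_max (iffLR (invariant_setP mA) IA) (iffLR (invariant_setP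
  mA') IA').
congr invariant_fun; apply/funext => x; rewrite !indicE in_setU.
by rewrite /Order.max; do 2 case: (_ \in _); rewrite /= ?ltxx ?ltr01 ?ltr10.
Qed.

(** Finite unions reduce the countable case to an increasing sequence, where continuity of [nu] from
    below passes the invariance to the limit. *)
Lemma invariant_sigma_algebra : sigma_algebra setT invariant_set.
Proof.
split=> [|A|A IA]; first exact: invariant_set0.
  by rewrite setTD; exact: invariant_setC.
pose U n := \big[setU/set0]_(i < n.+1) A i.
have IU n : invariant_set (U n).
  rewrite /U; elim: n.+1 => [|m IH]; first by rewrite big_ord0;
    exact: invariant_set0.
  by rewrite big_ord_recr; exact: invariant_setU.
have mA i : measurable (A i) by case: (IA i).
have UA : \bigcup_i A i = \bigcup_n U n by rewrite /U bigcup_bigsetU_bigcup.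
rewrite UA; have mU n : measurable (U n) by case: (IU n).
split; first exact: bigcupT_measurable.
have cvgU g : nu (gact g @^-1` U n) @[n --> \oo] --> nu (gact g @^-1` \bigcup_n
  U n).
  rewrite preimage_bigcup; apply: nondecreasing_cvg_mu.
  - by move=> n; exact: (measurable_gact_preimage BP).
  - by apply: bigcupT_measurable => n; exact: (measurable_gact_preimage BP).
  - move=> m n mn; apply/subsetPset; apply: preimage_subset.
    rewrite /U -!bigcup_mkord => x [i /= im Ax]; exists i => //=.
    exact: leq_trans im _.
move=> g l lL; apply: (cvg_unique _ (cvgU (g * l)%g)) => //.
rewrite (_ : (fun n => _) = (fun n => nu (gact g @^-1` U n)));
  first exact: cvgU.
by apply/funext => n; case: (IU n) => _; apply.
Qed.

Lemma transform_dominated (k : nat -> B -> R) f (M : R) g :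
  (forall n, bounded_measurable (k n)) -> bounded_measurable f ->
  (forall n x, `|k n x| <= M) -> (forall x, k n x @[n --> \oo] --> f x) ->
  tr (k n) g @[n --> \oo] --> tr f g.
Proof.
move=> bk bf kM kf.
have mE (h : B -> R) : bounded_measurable h ->
    measurable_fun setT (EFin \o (fun b => h (gact g b))).
  by move=> /(gact_integrable BP g)/integrableP[].
have kfE x : (k n (gact g x))%:E @[n --> \oo] --> (f (gact g x))%:E.
  by apply/fine_cvgP; split; [exact: nearW|exact: kf].
have [_ _ cvgk] := @dominated_convergence _ _ _ nu setT measurableT
  (fun n => EFin \o (fun b => k n (gact g b))) (EFin \o (fun b => f (gact g b)))
  (EFin \o (fun=> M)) (fun n => mE _ (bk n)) (mE _ bf)
  (aeW _ (fun x _ => kfE x)) 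
  (gact_integrable BP g (bounded_measurable_cst _ M))
  (aeW _ (fun x n _ => kM n (gact g x))).
apply: fine_cvg; rewrite fineK;
  last exact: integrable_fin_num (gact_integrable BP g bf).
exact: cvgk.
Qed.

(** The indicator is a bounded pointwise limit of functions made from [f] and constants by linear
    combinations and maxima, and invariance survives dominated convergence. *)
Lemma invariant_set_superlevel f (c : R) :
  invariant_fun f -> invariant_set [set x | c < f x].
Proof.
move=> If; have [[mf bf] _] := If.
pose A := [set x | c < f x].
have mA : measurable A.
  have mlt := measurable_fun_ltr (@measurable_cst _ _ _ _ setT c) mf.
  have := mlt measurableT [set true] I; rewrite setTI.
  by congr measurable; apply/seteqP; split => x.
apply/(invariant_setP mA); split; first exact: bounded_measurable_indic.
(* [k n] is min(1, n (f - c)^+), which increases to the indicator of [A]. *)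
pose F0 x := Num.max (1 * f x + - c) 0.
pose k (n : nat) x := -1 * Num.max (-1) (- n%:R * F0 x + 0) + 0.
(* The factor [1], the summands [0] and the minimum written as a negated maximum give each layer of
   [k n] the shape required by [invariant_fun_linear] or [invariant_fun_max]. *)
have Ik n : invariant_fun (k n).
  apply: invariant_fun_linear; last exact: invariant_fun_cst.
  apply: invariant_fun_max; first exact: invariant_fun_cst.
  apply: invariant_fun_linear; last exact: invariant_fun_cst.
  apply: invariant_fun_max; last exact: invariant_fun_cst.
  by apply: invariant_fun_linear => //; exact: invariant_fun_cst.
have F0_ge0 x : 0 <= F0 x by rewrite /F0 le_max lexx orbT.
have kle n x : `|k n x| <= 1.
  rewrite /k addr0 mulN1r normrN addr0 mulNr ler_norml le_max lexx/= ge_max.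
  by rewrite (le_trans _ ler01) ?oppr_le0// (le_trans _ ler01)// oppr_le0
    mulr_ge0.
have kA x : k n x @[n --> \oo] --> (\1_A x : R).
  have [Ax|nAx] := pselect (A x).
    have F0p : 0 < F0 x by rewrite /F0 mul1r lt_max subr_gt0 Ax.
    apply: cvg_near_cst; near=> n.
    rewrite indicE mem_set// /k.
    have -> : Num.max (-1) (- n%:R * F0 x + 0) = -1;
      last by rewrite mulN1r opprK addr0.
    apply/max_idPl; rewrite addr0 mulNr lerN2 -ler_pdivrMr//; near: n;
      exact: nbhs_infty_ger.
  rewrite indicE memNset//; apply: cvg_near_cst; apply: nearW => n.
  have H0 : F0 x = 0.
    by apply/max_idPr; rewrite mul1r subr_le0 leNgt; exact/negP.
  rewrite /k H0 mulr0 !addr0; have -> : Num.max (-1) 0 = 0 :> R.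
    by apply/max_idPr; rewrite oppr_le0.
  by rewrite mulr0.
have cvgk g := @transform_dominated k (\1_A) 1 g (fun n => (Ik n).1)
  (bounded_measurable_indic R mA) kle kA.
move=> g l lL; apply: (cvg_unique _ (cvgk (g * l)%g)) => //.
rewrite (_ : (fun n => _) = (fun n => tr (k n) g)); first exact: cvgk.
by apply/funext => n; case: (Ik n) => _; apply.
Unshelve. all: by end_near. Qed.

Lemma invariant_set_translate (A : set B) (k : G) :
  invariant_set A -> invariant_set (gact k @^-1` A).
Proof.
move=> [mA IA]; split; first exact: (measurable_gact_preimage BP).
have E g : gact g @^-1` (gact k @^-1` A) = gact (k * g)%g @^-1` A.
  apply/seteqP; split => x /=; by rewrite (boundary_action BP).2.
by move=> g l lL; rewrite !E mulgA; exact: IA.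
Qed.

(** The hypothesis says that [gact (g * l)] and [gact g] push [nu] to the same measure, so every
    transform takes equal values at [g * l] and [g]. *)
Lemma harmonic_right_invariant :
  (forall A : set B, measurable A -> invariant_set A) ->
  forall phi, bounded_harmonic tau phi -> right_invariant L phi.
Proof.
move=> all phi /(transform_onto BP)[f [mf bf] <-] g l lL.
apply: (eq_pushforward_Rintegral (phi := gact (g * l)%g) (psi := gact g)) => //.
- exact: (boundary_measurable BP).
- exact: (boundary_measurable BP).
- by move=> A mA; apply: (all A mA).2.
Qed.

(** Take a preimage [f] of [phi] and cut at a level [c] strictly between the two values: if [f <= c]
    almost everywhere then [phi g2 <= c], and if [f > c] almost everywhere then [phi g1 >= c]. *)
Lemma nontrivial_invariant_set phi g1 g2 :
  bounded_harmonic tau phi -> right_invariant L phi -> phi g1 < phi g2 ->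
  exists A : set B, [/\ invariant_set A, nu A <> 0%E & nu (~` A) <> 0%E].
Proof.
move=> hphi Iphi lt12; have [f bf trf] := transform_onto BP hphi.
have [c c1 c2] : exists2 c, phi g1 < c & c < phi g2.
  by exists ((phi g1 + phi g2) / 2); rewrite midf_lt.
have If : invariant_fun f by split; rewrite ?trf.
have IA := invariant_set_superlevel c If.
have [mA _] := IA.
exists [set x | c < f x]; split => //.
- move=> A0; have : phi g2 <= c.
    rewrite -trf -(transform_cst B c g2); apply: (transform_ae_le BP) => //.
      exact: bounded_measurable_cst.
    by exists [set x | c < f x]; split => // x /= /negP; rewrite -ltNge.
  by rewrite leNgt c2.
- move=> A0; have : c <= phi g1.
    rewrite -trf -(transform_cst B c g1); apply: (transform_ae_le BP) => //.
      exact: bounded_measurable_cst.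
    exists (~` [set x | c < f x]); split => //; first exact: measurableC.
    by move=> x /= h cf; apply: h; exact: ltW.
  by rewrite leNgt c1.
Qed.

End invariant_algebra.

(** * The factor generated by an invariant set *)

(* A copy of [cantor_space] that depends on R, to carry an R-valued pseudometric. *)
Definition cantor (R : realType) : Type := prod_topology (fun _ : nat => bool).
HB.instance Definition _ (R : realType) := Pointed.on (cantor R).
HB.instance Definition _ (R : realType) := Uniform.on (cantor R).
HB.instance Definition _ (R : realType) : PseudoMetric R (cantor R) :=
  PseudoMetric.copy (cantor R)
    (prod_topology (fun _ : nat => (bool : pseudoMetricType R))).

Lemma cantor_compact (R : realType) : compact [set: cantor R].
Proof. exact: cantor_space_compact. Qed.

Lemma cantor_cauchy_cvg (R : realType) (F : set_system (cantor R)) :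
  ProperFilter F -> cauchy F -> cvg F.
Proof.
move=> PF cF; apply: (compact_cauchy_cvg PF cF filterT).
exact: cantor_compact.
Qed.

HB.instance Definition _ (R : realType) :=
  Uniform_isComplete.Build (cantor R) (@cantor_cauchy_cvg R).

Lemma second_countable_separable (T : ptopologicalType) :
  @second_countable T -> exists2 D : set T, countable D & dense D.
Proof.
move=> [B cB [oB bB]].
pose pt (A : set T) : T := if pselect (A !=set0) is left h then sval (cid h)
  else point.
exists (pt @` B); first exact: (card_le_trans (card_image_le _ _) cB).
move=> U [x Ux] oU.
have [V /= [BV Vx VU]] := bB x U (open_nbhs_nbhs (conj oU Ux)).
exists (pt V); split; last by exists V.
apply: VU; rewrite /pt; case: pselect => [h|[]]; last by exists x.
exact: (svalP (cid h)).
Qed.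

Lemma cantor_polish (R : realType) : polish (cantor R).
Proof.
split; first exact: cantor_space_hausdorff.
apply: second_countable_separable.
exact/(@compact_second_countable R)/cantor_compact.
Qed.

Lemma cantor_standard (R : realType) : standard_borel R (borel (cantor R)).
Proof.
by exists (cantor R), id, id; split => //; apply: cantor_polish.
Qed.

Definition coordinate_sets (R : realType) : set (set (cantor R)) :=
  range (fun n => [set x : cantor R | x n]).

Arguments coordinate_sets : clear implicits.

(** Each subbasic neighbourhood constrains one coordinate, so the filter generated by agreement on
    initial segments converges to [x]. *)
Lemma nbhs_cantor (R : realType) (x : cantor R) (U : set (cantor R)) :
  nbhs x U -> exists n, [set y | forall i, (i < n)%N -> y i = x i] `<=` U.
Proof.
pose F := filter_from [set: nat]
  (fun n => [set y : cantor R | forall i, (i < n)%N -> y i = x i]).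
have FF : Filter F.
  apply: filter_from_filter; first by exists 0%N.
  move=> m n _ _; exists (maxn m n) => // y yx; split => i ilt; apply: yx.
    exact: leq_trans ilt (leq_maxl _ _).
  exact: leq_trans ilt (leq_maxr _ _).
suff : F --> x by move=> h /h [n _ nU]; exists n.
apply/cvg_sup => i V [B [[W oW <-] Wx] BV].
exists i.+1 => // y yx; apply: BV; rewrite /= yx//.
Qed.


(** An open set is the union of the cylinders it contains, and these are indexed by the countably
    many finite binary words. *)
Lemma open_cantor (R : realType) (U : set (cantor R)) :
  open U -> <<s coordinate_sets R >> U.
Proof.
move=> oU; pose T := g_sigma_algebraType (coordinate_sets R).
pose cyl (s : seq bool) : set T :=
  [set x | forall i, (i < size s)%N -> x i = nth false s i].
have mi i : measurable ([set x | x i] : set T).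
  by apply: sub_sigma_algebra; exists i.
have mcyl s : measurable (cyl s).
  (* For indices beyond the length of [s] the second member is everything, so no condition is
     imposed there. *)
  have -> : cyl s = \bigcap_i ([set x : T | x i = nth false s i] `|`
                               (if (i < size s)%N then set0 else setT)).
    apply/seteqP; split => [x sx i _|x sx i ilt].
      by case: ifPn => [/sx|]; [left|right].
    by have := sx i I; rewrite ilt setU0.
  apply: bigcapT_measurable => i; apply: measurableU; last by case: ifP.
  case: nth; first exact: mi.
  rewrite (_ : [set x | _] = ~` [set x : T | x i]);
    first by apply: measurableC; exact: mi.
  by apply/seteqP; split => x /= => [->//|/negP/negbTE].
suff -> : U = \bigcup_(s in [set s | cyl s `<=` U]) cyl s.
  have : measurable (\bigcup_(s in [set s | cyl s `<=` U]) cyl s); last exact.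
  rewrite bigcup_mkcond; apply: countable_bigcupT_measurable => // s.
  by case: ifP.
apply/seteqP; split => [x Ux|x [s sU]]; last exact: sU.
have [n nU] := nbhs_cantor (open_nbhs_nbhs (conj oU Ux)).
have xE i : (i < n)%N -> nth false (mkseq x n) i = x i by exact: nth_mkseq.
exists (mkseq x n) => /= [y yx|i]; last first.
  by rewrite size_mkseq => /xE.
by apply: nU => i ilt; rewrite -xE// yx// size_mkseq.
Qed.

Lemma measurable_cantor_map (R : realType) d (X : measurableType d)
    (f : X -> borel (cantor R)) :
  (forall n, measurable [set x | f x n]) -> measurable_fun setT f.
Proof.
move=> mf; apply: (@measurability _ _ X (borel (cantor R)) _ _ (@open (cantor
  R))) => //.
move=> _ [B oB <-]; rewrite setTI.
have : measurable_fun setT (f : X -> g_sigma_algebraType (coordinate_sets R)).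
  apply: (@measurability _ _ X (g_sigma_algebraType (coordinate_sets R)) _ _
    (coordinate_sets R)) => //.
  by move=> _ [_ [n _ <-] <-]; rewrite setTI; exact: mf.
by move=> /(_ measurableT B (open_cantor oB)); rewrite setTI.
Qed.

Lemma measurable_coordinate (R : realType) (n : nat) :
  measurable ([set x | x n] : set (borel (cantor R))).
Proof.
apply: sub_sigma_algebra; rewrite -[X in open X]/(proj n @^-1` [set` id]).
apply: open_comp => [x _|];
  first exact: (@proj_continuous nat (fun=> bool) n x).
exact: discrete_open.
Qed.

(** * The itinerary map to the Cantor space and the factor it defines *)

Section itinerary.
Context (R : realType) (G : groupType) (c : G -> nat).
Hypothesis c_inj : injective c.

Definition decode (n : nat) : option G :=
  if pselect (exists g, c g = n) is left h then Some (sval (cid h)) else None.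

Lemma decodeK : pcancel c decode.
Proof.
move=> g; rewrite /decode; case: pselect => [h|[]]; last by exists g.
by congr Some; apply: c_inj; exact: (svalP (cid h)).
Qed.

(* Coordinates outside of the range of [c] are left fixed, so that [shift 1] is the
   identity. *)
Definition shift (g : G) (y : borel (cantor R)) : borel (cantor R) :=
  fun n => if decode n is Some k then y (c (g^-1 * k)%g) else y n.

Lemma shift_action : is_action shift.
Proof.
split=> [y|g h y]; apply/funext => n; rewrite /shift;
  case E: (decode n) => [k|//].
  rewrite invg1 mul1g; move: E; rewrite /decode; case: pselect => // h [<-].
  by rewrite (svalP (cid h)).
by rewrite decodeK invgM mulgA.
Qed.

Lemma measurable_shift g : measurable_fun setT (shift g).
Proof.
apply: measurable_cantor_map => n; rewrite /shift.
by case: (decode n) => [k|]; exact: measurable_coordinate.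
Qed.

Section factor.
Context (tau : probability (discrete G) R) (B : gspace R G).
Hypothesis Bspace : borel_gspace tau B.
Context (A : set B).
Hypothesis mA : measurable A.

(** The inverse on [g] makes the map equivariant for the left shift. *)
Definition itinerary (b : B) : borel (cantor R) :=
  fun n => if decode n is Some g then `[< A (gact g^-1%g b) >] else false.

Lemma itinerary_equivariant g b : itinerary (gact g b) = shift g (itinerary b).
Proof.
apply/funext => n; rewrite /itinerary /shift.
case E: (decode n) => [k|//]; rewrite decodeK.
by rewrite invgM invgK (gspace_action Bspace).2.
Qed.

Lemma itinerary_coordinate n : [set b | itinerary b n] =
  if decode n is Some g then gact g^-1%g @^-1` A else set0.
Proof.
rewrite /itinerary; case: (decode n) => [g|]; apply/seteqP; split => b //=.
  by move/asboolP.
by move=> ?; apply/asboolP.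
Qed.

Lemma measurable_itinerary : measurable_fun setT itinerary.
Proof.
apply: measurable_cantor_map => n; rewrite itinerary_coordinate.
case: (decode n) => [g|//]; rewrite -[X in measurable X]setTI.
exact: (gspace_measurable Bspace).
Qed.

Definition itinerary_mfun : {mfun B >-> borel (cantor R)} :=
  HB.pack_for {mfun B >-> borel (cantor R)} itinerary
    (isMeasurableFun.Build _ _ B (borel (cantor R)) itinerary
      measurable_itinerary).

Definition factor : gspace R G :=
  @GSpace R G _ (borel (cantor R)) shift (distribution (glaw B) itinerary_mfun).

Lemma factor_borel_gspace : borel_gspace tau factor.
Proof.
split.
- exact: cantor_standard.
- exact: shift_action.
- exact: measurable_shift.
- move=> C mC /=.
  have mIC : measurable (itinerary @^-1` C).
    by rewrite -[X in measurable X]setTI; exact: measurable_itinerary.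
  rewrite -[RHS](gspace_stationary Bspace mIC); apply: eq_esum => g _.
  congr (_ * _)%E; rewrite /= /pushforward /distribution /pushforward /=.
  congr (glaw B _); apply/seteqP.
  by split => b /=; rewrite itinerary_equivariant.
Qed.

Lemma itinerary_gmap : @gmap R G B factor itinerary.
Proof.
exists setT, setT; split => //.
- by split => //; rewrite setCT measure0.
- by split => //; rewrite setCT measure0.
- exact: measurable_itinerary.
- by move=> g x _; rewrite itinerary_equivariant.
- by move=> C mC; rewrite setTI.
Qed.

(** If the law of the itinerary were a point mass at [y], its coordinate at the identity would be
    almost surely constant, so [A] or its complement would be null. *)
Lemma factor_nontrivial :
  glaw B A <> 0%E -> glaw B (~` A) <> 0%E -> ~ trivial_gspace factor.
Proof.
move=> A0 cA0 [y /=]; rewrite /distribution /pushforward /= => y1.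
have A1 b : itinerary b (c 1%g) = `[< A b >].
  by rewrite /itinerary decodeK invg1 (gspace_action Bspace).1.
have null (D D' : set B) : measurable D -> measurable D' -> glaw B D = 1%E ->
    D `<=` ~` D' -> glaw B D' = 0%E.
  move=> mD mD' D1 DD'; apply/eqP; rewrite eq_le measure_ge0 andbT.
  apply: (@le_trans _ _ (glaw B (~` D))).
    by apply: le_measure; rewrite ?inE//;
      [exact: measurableC|move=> x /[swap] /DD'].
  by rewrite probability_setC// D1 subee.
have my : measurable (itinerary @^-1` [set y]).
  rewrite -[X in measurable X]setTI; apply: measurable_itinerary => //.
  (* Singletons are Borel as countable intersections of coordinate conditions. *)
  rewrite (_ : [set y] = \bigcap_n [set x | x n = y n]).
    apply: bigcapT_measurable => n; case: (y n).
      exact: measurable_coordinate.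
    rewrite (_ : [set x | _] = ~` [set x : borel (cantor R) | x n]).
      by apply: measurableC; exact: measurable_coordinate.
    by apply/seteqP; split => x /= => [->//|/negP/negbTE].
  apply/seteqP; split => [x -> //|x xy].
  by apply/funext => n; exact: xy.
have [yt|yf] := boolP (y (c 1%g)).
  apply: cA0; apply: (null _ _ my _ y1); first exact: measurableC.
  by rewrite setCK => b /= by_; apply/asboolP; rewrite -A1 by_.
apply: A0; apply: (null _ _ my _ y1) => // b /= by_ Ab.
by move/negP: yf; apply; rewrite -by_ A1; apply/asboolP.
Qed.

End factor.
End itinerary.


(** All translates of [A] are in S, hence so are all itinerary preimages of Borel sets. When the
    itinerary map has a measurable inverse on a conull set, every measurable set is such a preimage
    up to a null set. *)
Lemma invariant_set_of_iso (R : realType) (G : groupType) (L : groupClosed G)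
    (tau : probability (discrete G) R) (B : gspace R G) (c : G -> nat)
    (A : set B) (X0 : set B) (Y0 : set (borel (cantor R)))
    (h : borel (cantor R) -> B) :
  countable [set: G] -> absorbing L tau -> poisson_boundary tau B ->
  invariant_set L A ->
  invariant_conull X0 -> measurable Y0 -> measurable_fun Y0 h ->
  (forall x, X0 x -> Y0 (itinerary c A x)) ->
  (forall x, X0 x -> h (itinerary c A x) = x) ->
  forall D : set B, measurable D -> invariant_set L D.
Proof.
move=> Gcount tauL BP IA [mX0 X0g X00] mY0 mh XY hK D mD.
have [I0 IC IU] := invariant_sigma_algebra Gcount tauL BP.
have sa : sigma_algebra setT
    [set C : set (cantor R) | invariant_set L (itinerary c A @^-1` C)].
  split=> [|C /= CI|F FI] /=.
  - by rewrite preimage_set0.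
  - by rewrite setTD -preimage_setC -setTD; exact: IC.
  - by rewrite preimage_bigcup; exact: IU.
have coord : <<s coordinate_sets R >> `<=`
    [set C : set (cantor R) | invariant_set L (itinerary c A @^-1` C)].
  apply: smallest_sub => // _ [n _ <-] /=.
  rewrite (_ : _ @^-1` _ = [set b | itinerary c A b n])//.
  rewrite itinerary_coordinate; case: (decode c n) => [g|]; last exact: I0.
  exact: (invariant_set_translate BP).
have borelI : <<s @open (cantor R) >> `<=`
    [set C : set (cantor R) | invariant_set L (itinerary c A @^-1` C)].
  by apply: smallest_sub => // U oU; apply: coord; exact: open_cantor.
pose C := Y0 `&` h @^-1` D.
have [mC' IC'] := borelI C (mh mY0 _ mD).
split => // g l lL.
(* [D] and the preimage of [C] agree on [X0]. Since [X0] is invariant as well as conull, so do their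
   translates, up to a null set. *)
have E g' : glaw B (gact g' @^-1` D) = glaw B (gact g' @^-1` (itinerary c A
  @^-1` C)).
  have conull (S : set B) : measurable S -> glaw B S = glaw B (S `&` X0).
    move=> mS; rewrite [LHS](measureDI _ mS mX0) [X in (X + _)%E](_ : _ = 0%E)
      ?add0e//.
    apply/eqP; rewrite eq_le measure_ge0 andbT -X00.
    by apply: le_measure; [rewrite inE; exact: measurableD|rewrite inE;
      exact: measurableC|move=> x []].
  rewrite conull; last exact: (measurable_gact_preimage BP).
  rewrite [RHS]conull; last exact: (measurable_gact_preimage BP).
  congr (glaw B _); apply/seteqP; split => x [/= Dx Xx]; split => //.
    by split; [exact/XY/X0g|rewrite /= hK//; exact: X0g].
  by case: Dx => _ /=; rewrite hK//; exact: X0g.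
by rewrite !E IC'.
Qed.



(** * Non-primeness of the measured group *)

Unset Implicit Arguments.

Theorem corollary1p12 (R : realType) (Gamma : groupType)
    (Lambda : groupClosed Gamma)
    (Gamma_countable : countable [set: Gamma])
    (Hecke : hecke_pair Lambda)
    (Lambda_nonamenable : ~ amenable R Lambda)
    (Lambda_noncoamenable : ~ coamenable R Lambda)
    (tau : probability (discrete Gamma) R)
    (tau_spread_out : spread_out tau)
    (tau_absorbing : absorbing Lambda tau) :
  ~ prime_measured_group tau.
Proof.
move=> [B BP [Bspace _ Bprime]].
apply: Lambda_noncoamenable.
apply: (coamenable_of_constant_harmonic Gamma_countable tau_absorbing).
move=> phi hphi Iphi g; apply: contrapT => /eqP phig.
(* A non-constant right [Lambda]-invariant harmonic function [phi] is now at hand; with primeness it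
   will force all bounded harmonic functions to be right [Lambda]-invariant. *)
apply: Lambda_nonamenable.
apply: (amenable_of_invariant_harmonic (tau := tau) Gamma_countable).
have [g1 [g2 lt12]] : exists g1 g2, phi g1 < phi g2.
  by move: phig; rewrite neq_lt => /orP[lt|lt]; [exists g, 1%g|exists 1%g, g].
have [A [IA A0 cA0]] := nontrivial_invariant_set Gamma_countable tau_absorbing
  BP hphi Iphi lt12.
have [mA _] := IA.
have /countable_injP[c cinj] := Gamma_countable.
have c_inj : injective c by move=> x y; apply: cinj; exact: mem_set.
apply: (harmonic_right_invariant BP).
(* Primeness is applied to the itinerary map of [A]; its target is not trivial, so the map is an
   isomorphism. *)
have [|triv] := Bprime (factor c Bspace mA) _
  (factor_borel_gspace c_inj Bspace mA) (itinerary_gmap c_inj Bspace mA);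
    last first.
  by case: (factor_nontrivial c_inj A0 cA0 triv).
move=> [X0 [Y0 [h [[cX0 [mY0 _ _] XY _ _ _] YX hK _]]]].
have [_ _ _ mh _ _] := YX.
exact: (invariant_set_of_iso Gamma_countable tau_absorbing BP IA cX0 mY0 mh XY
  hK).
Qed.
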